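(* Let $G$ be a graph, $s\in V(G)$, $0\le p<1\le a$, $c>0$, $K>0$, and $L=\lceil c\,e\,a\,K\rceil$ (where $e$ is the base of the natural logarithm) be such that $\Pr\{\tau(G,s)>K\}\le p$ and $\Pi(G,s,L)\le a^L$. Then $h(\mathcal{T}(G,s))\le L$ with probability at least $1-p-c^{-L}$.
   Context: All graphs are finite, simple, undirected and connected. For a graph $G$ on $n$ vertices and $s\in V(G)$, build random subtrees $T_1,\dots,T_n$ of $G$: $T_1$ is the single vertex $s$, and for $1<i\le n$, $T_i$ is obtained from $T_{i-1}$ by choosing, uniformly at random, an edge of $G$ with exactly one endpoint in $T_{i-1}$ and adding it (with its other endpoint) to $T_{i-1}$. The random spanning tree $T_n$, rooted at $s$, is denoted $\mathcal{T}(G,s)$. The height $h(T)$ of a rooted tree $T$ is the maximum number of edges on a root-to-leaf path. First-passage percolation: assign independent exponential random variables $\tau(e)$ of mean $1$ to the edges $e$ of $G$. For a path $\gamma$ put $\tau(\gamma)=\sum_{e\in\gamma}\tau(e)$. For $s,v\in V(G)$ let $\Gamma(s,v)$ be the set of all $(s,v)$-paths in $G$, let $\tau(G,s,v)=\min_{\gamma\in\Gamma(s,v)}\tau(\gamma)$, and let the first-passage percolation cover time be $\tau(G,s)=\max_{v\in V(G)}\tau(G,s,v)$. For a positive integer $L$, $\Pi(G,s,L)$ denotes the number of simple paths of length $L$ (i.e. with $L$ edges) in $G$ that start from $s$. *)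

(* Defs.v *)
From HB Require Import structures.
From mathcomp Require Import all_boot all_order all_algebra.
From mathcomp Require Import all_classical all_reals all_analysis.
Set Implicit Arguments.
Unset Strict Implicit.
Unset Printing Implicit Defensive.
Import Order.TTheory GRing.Theory Num.Theory.
Local Open Scope ring_scope.

(* A finite simple connected graph is a finType of vertices with an adjacency
   relation; its edges are the two-element sets of adjacent vertices. *)
Definition connected_sgraph (V : finType) (E : rel V) : Prop :=
  [/\ symmetric E, irreflexive E & forall x y, connect E x y].

Definition edges (V : finType) (E : rel V) : {set {set V}} :=
  [set [set xy.1; xy.2]%SET | xy : V * V & E xy.1 xy.2]%SET.

(* The vertex sequence of a path is s :: q; its length (number of edges) is
   size q. *)
Definition simple_path (V : finType) (E : rel V) (s : V) (q : seq V) : bool :=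
  path E s q && uniq (s :: q).

Definition num_simple_paths (V : finType) (E : rel V) (s : V) (L : nat) : nat :=
  #|[set q : L.-tuple V | simple_path E s q]%SET|.

Section RandomTree.
Variables (R : realType) (V : finType).

(* A subgraph of G, given by its vertex set and its edge set. *)
Definition subgraph : Type := ({set V} * {set {set V}})%type.

Definition tree_start (s : V) : subgraph := ([set s]%SET, finset.set0).

Definition out_edges (E : rel V) (T : subgraph) : {set {set V}} :=
  [set f in edges E | #|f :&: T.1| == 1%N]%SET.

Definition add_edge (T : subgraph) (f : {set V}) : subgraph :=
  (T.1 :|: f, f |: T.2)%SET.

(* Probability that T becomes T' when a uniformly random edge of
   out_edges E T is added to T. *)
Definition tree_step (E : rel V) (T T' : subgraph) : R :=
  #|[set f in out_edges E T | add_edge T f == T']%SET|%:R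
  / #|out_edges E T|%:R.

(* tree_law E s k is the law (probability mass function) of the random tree
   obtained after k additions, i.e. of T_(k + 1). *)
Fixpoint tree_law (E : rel V) (s : V) (k : nat) (T : subgraph) : R :=
  if k is j.+1 then \sum_(T0 : subgraph) tree_law E s j T0 * tree_step E T0 T
  else (T == tree_start s)%:R.

(* Pr{A(T(G,s))}, where T(G,s) = T_n with n = #|V|. *)
Definition spanning_tree_prob (E : rel V) (s : V) (A : pred subgraph) : R :=
  \sum_(T : subgraph | A T) tree_law E s #|V|.-1 T.

End RandomTree.

Section Height.
Variable V : finType.

Definition adjacent_in (T : subgraph V) : rel V :=
  fun x y => [set x; y]%SET \in T.2.

(* A leaf of a tree rooted at s has no children: it is a non-root vertex of
   degree 1, or the root itself in the one-vertex tree. *)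
Definition is_leaf (s : V) (T : subgraph V) (v : V) : bool :=
  #|[set y | adjacent_in T v y]%SET| == (v != s).

Definition height (s : V) (T : subgraph V) : nat :=
  \max_(q : #|V|.-bseq V |
          simple_path (adjacent_in T) s q && is_leaf s T (last s q)) size q.

End Height.

(* Mutual independence of the random variables X i, i in A. *)
Definition mutually_independent (d : measure_display) (Omega : measurableType d)
    (R : realType) (P : probability Omega R) (I : finType) (A : {set I})
    (X : I -> {RV P >-> R}) : Prop :=
  forall (J : {set I}) (B : I -> set R), J \subset A ->
    (forall i, measurable (B i)) ->
    P (\bigcap_(i in [set` J]) (X i @^-1` B i))%classic
    = (\prod_(i in J) P (X i @^-1` B i)%classic)%E.

(* Passage times on the edges of G; tau is only constrained on edges E. *)
Definition iid_exp1_on_edges (V : finType) (E : rel V) (d : measure_display)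
    (Omega : measurableType d) (R : realType) (P : probability Omega R)
    (tau : {set V} -> {RV P >-> R}) : Prop :=
  mutually_independent (edges E) tau /\
  (forall f, f \in edges E -> forall B : set R, measurable B ->
     distribution P (tau f) B = exponential_prob 1 B).

Section FirstPassage.
Variables (R : realType) (V : finType) (E : rel V).

(* Here t is one realization of the edge passage times. *)
Definition path_time (t : {set V} -> R) (s : V) (q : seq V) : R :=
  \sum_(xy <- zip (s :: q) q) t [set xy.1; xy.2]%SET.

(* The values +oo and -oo are only the units of min and max: in a connected
   graph there is an (s, v)-path for each v. *)
Definition passage_time (t : {set V} -> R) (s v : V) : \bar R :=
  \big[Order.min/+oo%E]_(q : #|V|.-bseq V |
      simple_path E s q && (last s q == v)) (path_time t s q)%:E.

Definition cover_time (t : {set V} -> R) (s : V) : \bar R :=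
  \big[Order.max/-oo%E]_(v : V) passage_time t s v.

End FirstPassage.

(* Main.v *)
Require Import Defs.
From HB Require Import structures.
From mathcomp Require Import all_boot all_order all_algebra.
From mathcomp Require Import all_classical all_reals all_analysis.
From mathcomp Require Import measurable_realfun ring lra.
Set Implicit Arguments.
Unset Strict Implicit.
Unset Printing Implicit Defensive.
Import Order.TTheory GRing.Theory Num.Theory.
Import numFieldNormedType.Exports.
Local Open Scope ring_scope.

(** The random tree is the shortest path tree of first-passage percolation,
    and a tall shortest path tree that is built quickly contains a long path of
    small passage time, which is unlikely.

    A history is a list of edges, most recent first, along which the tree may
    have grown.  Given passage times [t], let every vertex of the tree be born
    when it is reached from the root inside the tree.  The time at which a
    boundary edge would reach its outer endpoint is its arrival, and
    [explored E s t fs] says that at each stage of [fs] the edge that was added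
    is the one that arrives strictly first, and that no edge of the present
    boundary has arrived yet.

    Conditionally on a history, the residual times of the boundary edges are
    independent exponential variables of mean 1, by lack of memory.  Hence all
    of them are equally likely to arrive first ([pr_first_sym]), and one more
    edge costs at least a factor [#|boundary E s fs|] in probability
    ([pr_explored_cons]).  Summing over the histories that lead to a tree shows
    that first-passage percolation produces that tree with probability at most
    [tree_law] ([histories_tree_law]).  This inequality suffices, because ties
    and nonpositive passage times have probability 0 and without them some
    complete history is explored ([explored_exists]).

    The lack of memory is used for two edges at a time.  The joint law of the
    passage times is invariant under redrawing one of them ([resampling_law]).
    Redrawing two boundary edges [f] and [g] reduces the claim to two
    independent exponential clocks that have already run for the times [a] and
    [b] ([exp1_race_sym]).

    On an explored history the path from the root to [v] in the tree takes
    exactly the birth time of [v] ([tree_path_time]), which is at most the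
    passage time of [v] ([birth_le_path_time]).  So if the cover time is at
    most [K] and the height exceeds [L], then the first [L] edges of a longest
    root-to-leaf path form a simple path of [G] of passage time at most [K]
    ([fast_path]).  By a Chernoff bound a given path of length [L] is that fast
    with probability at most [(e K / L) ^ L] ([pr_fast_path]).  There are at
    most [a ^ L] such paths and [L >= c e a K], so some path is that fast with
    probability at most [c ^ (- L)]. *)

(** * The exponential law of mean one *)

Lemma measurable_bool_EFin (R : realType) d (T : measurableType d) (b : T -> bool) :
  measurable_fun setT b -> measurable_fun setT (fun x => (b x)%:R%:E : \bar R).
Proof.
move=> mb; rewrite (_ : (fun x => _) = fun x => if b x then 1%E else 0%E).
  exact: measurable_fun_ifT.
by apply/funext => x; case: (b x).
Qed.

Section Exp1.
Local Open Scope classical_set_scope.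
Local Open Scope ereal_scope.
Context {R : realType}.
Local Notation leb := (@lebesgue_measure R).

(** A constant of its own, so that the probability structure, which for a general
    rate needs a proof that the rate is positive, is found by inference. *)
Definition exp1 : set (measurableTypeR R) -> \bar R := exponential_prob 1%R.

HB.instance Definition _ := Probability.copy exp1
  (exponential_distribution_exponential_prob__canonical__probability_measure_Probability
     (@ltr01 R)).

Lemma exp1_dominated : exp1 `<< leb.
Proof.
apply/null_content_dominatesP => A mA A0; rewrite /exp1 /exponential_prob.
apply/eqP; rewrite eq_le; apply/andP; split; last first.
  by apply: integral_ge0 => x _; rewrite lee_fin exponential_pdf_ge0.
apply: (@le_trans _ _ (\int[leb]_(x in A) 1)); last first.
  by rewrite integral_cst// mul1e A0.
apply: ge0_le_integral => //=.
- by move=> x _; rewrite lee_fin exponential_pdf_ge0.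
- apply/measurable_EFinP/measurable_funTS; exact: measurable_exponential_pdf.
- move=> x _; rewrite lee_fin; have [x0|x0] := leP 0%R x.
    by rewrite exponential_pdfE// mul1r mulN1r -expR0 ler_expR oppr_le0.
  by rewrite lt0_exponential_pdf// ler01.
Qed.

(** Turns integrals against the law into Lebesgue integrals: the density is a
    Radon-Nikodym derivative, which is unique almost everywhere. *)
Lemma integral_exp1 (f : measurableTypeR R -> \bar R) : measurable_fun setT f ->
  (forall x, 0 <= f x) ->
  \int[exp1]_x f x = \int[leb]_x (f x * (exponential_pdf 1 x)%:E).
Proof.
move=> mf f0.
rewrite -(Radon_Nikodym_SigmaFinite.change_of_variables exp1_dominated f0 measurableT)//.
have mpdf : measurable_fun [set: measurableTypeR R]
    (fun x => (exponential_pdf 1 x)%:E).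
  by apply/measurable_EFinP; exact: measurable_exponential_pdf.
have iRN := Radon_Nikodym_SigmaFinite.f_integrable exp1_dominated.
apply: ae_eq_integral => //.
- by apply: emeasurable_funM => //; exact: measurable_int iRN.
- exact: emeasurable_funM.
- apply: ae_eqe_mul2l; apply: integral_ae_eq => // E _ mE.
  by rewrite -(Radon_Nikodym_SigmaFinite.f_integral exp1_dominated mE).
Qed.

Lemma lebesgue_measure_translate (a : R) (A : set (measurableTypeR R)) :
  measurable A -> pushforward leb (fun x : measurableTypeR R => x + a)%R A = leb A.
Proof.
move=> mA; apply/esym.
pose shift (x : measurableTypeR R) : measurableTypeR R := (x + a)%R.
have mt : measurable_fun setT shift by exact: measurable_funD.
pose h : {mfun measurableTypeR R >-> measurableTypeR R} :=
  HB.pack shift (isMeasurableFun.Build _ _ _ _ _ mt).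
apply: (@lebesgue_measure_unique _ (pushforward leb h)) => //= _ [[b c]] _ <-.
rewrite /pushforward.
have -> : h @^-1` `]b, c] = `](b - a)%R, (c - a)%R].
  by apply/seteqP; split=> x /=; rewrite !in_itv /= ltrBlDr lerBrDr.
rewrite !lebesgue_measure_itv/= !lte_fin ltrD2r.
by case: ifP => // _; rewrite -!EFinD; congr (_%:E); ring.
Qed.

(** Lack of memory: on [x > a] the density at [x] is [exp (- a)] times the density
    at [x - a], and Lebesgue measure is invariant under translation. *)
Lemma integral_exp1_shift (a : R) (h : measurableTypeR R -> \bar R) : (0 <= a)%R ->
  measurable_fun setT h -> (forall x, 0 <= h x) ->
  \int[exp1]_x ((a < x)%R%:R%:E * h (x - a)%R)
    = (expR (- a))%:E * \int[exp1]_x ((0 < x)%R%:R%:E * h x).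
Proof.
move=> a0 mh h0.
have mlt b : measurable_fun [set: measurableTypeR R]
   (fun x : measurableTypeR R => (b < x)%R%:R%:E : \bar R).
  by apply: measurable_bool_EFin; exact: measurable_fun_ltr.
have mhs : measurable_fun [set: measurableTypeR R] (fun x => h (x - a)%R).
  by apply: measurableT_comp => //; apply: measurable_funB.
have mpdf : measurable_fun [set: measurableTypeR R]
    (fun x => (exponential_pdf 1 x)%:E).
  by apply/measurable_EFinP; exact: measurable_exponential_pdf.
rewrite !integral_exp1//; first last.
- by move=> x; rewrite mule_ge0.
- exact: emeasurable_funM.
- by move=> x; rewrite mule_ge0.
- exact: emeasurable_funM.
have mt : measurable_fun [set: measurableTypeR R]
    (fun x => (x + a)%R : measurableTypeR R) by exact: measurable_funD.
rewrite -ge0_integralZl//; first last.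
- by move=> x _; rewrite !mule_ge0// lee_fin exponential_pdf_ge0.
- by do !apply: emeasurable_funM.
have leb_shift F : measurable_fun setT F -> (forall x, 0 <= F x) ->
    \int[leb]_x F x = \int[leb]_x F (x + a)%R.
  move=> mF F0; rewrite -(@ge0_integral_pushforward _ _ _ _ _ _ mt leb setT F)//.
  by apply: eq_measure_integral => A mA _; apply/esym/lebesgue_measure_translate.
rewrite leb_shift; first last.
- by move=> x; rewrite !mule_ge0// lee_fin exponential_pdf_ge0.
- by do !apply: emeasurable_funM.
apply: eq_integral => x _; rewrite addrK ltrDr.
have [x0|x0] := ltP 0%R x; last by rewrite !mul0e mule0.
rewrite !mul1e !exponential_pdfE//; [|exact: ltW|by rewrite addr_ge0// ltW].
rewrite !mul1r !mulN1r opprD expRD EFinM.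
by rewrite [(expR (- x))%:E * _]muleC muleCA.
Qed.

Lemma exp1_set1 x : exp1 [set x] = 0.
Proof.
have /null_content_dominatesP dom := exp1_dominated.
by apply: dom => //; exact: lebesgue_measure_set1.
Qed.

Lemma exp1_le0 : exp1 [set x | (x <= 0)%R] = 0.
Proof.
have mlt0 : measurable ([set x | (x < 0)%R] : set (measurableTypeR R)).
  by rewrite -[X in measurable X]setTI; exact: measurable_fun_ltr.
rewrite (_ : [set x | _] = [set x | (x < 0)%R] `|` [set 0%R]); last first.
  apply/seteqP; split=> x /=; rewrite le_eqVlt.
    by move=> /predU1P; tauto.
  by move=> ?; apply/predU1P; tauto.
apply/eqP; rewrite eq_le measure_ge0 andbT.
have -> : 0 = exp1 [set x | (x < 0)%R] + exp1 [set 0%R] :> \bar R.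
  rewrite exp1_set1 adde0 /exp1 /exponential_prob integral0_eq//.
  by move=> x /= x0; rewrite lt0_exponential_pdf.
exact: measureU2.
Qed.

(** The exact value is [1 / (1 + t)].  The bound [1 / t] drops the factor
    [exp (- x)], after which the density of rate [t] integrates to 1; with
    [t = L / K] it still gives the Chernoff bound [(e K / L) ^ L]. *)
Lemma exp1_laplace (t : R) : (0 < t)%R ->
  \int[exp1]_x (expR (- t * x))%:E <= (t^-1)%:E.
Proof.
move=> t0.
have mpdf (r : R) : measurable_fun [set: measurableTypeR R]
    (fun x => (exponential_pdf r x)%:E).
  by apply/measurable_EFinP; exact: measurable_exponential_pdf.
have mexp : measurable_fun [set: measurableTypeR R] (fun x => (expR (- t * x))%:E).
  by apply/measurable_EFinP/measurableT_comp => //; apply: measurable_funM.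
rewrite integral_exp1//.
rewrite -[leRHS]mule1 -(integral_exponential_pdf t0) -ge0_integralZl//; first last.
- by rewrite lee_fin invr_ge0 ltW.
- by move=> x _; rewrite lee_fin exponential_pdf_ge0// ltW.
apply: ge0_le_integral => //.
- by move=> x _; rewrite mule_ge0// lee_fin ?expR_ge0// exponential_pdf_ge0.
- exact: emeasurable_funM.
- exact: emeasurable_funM.
move=> x _; rewrite -!EFinM lee_fin.
have [x0|x0] := leP 0%R x; last by rewrite !lt0_exponential_pdf ?mulr0// ltW.
rewrite !exponential_pdfE//.
rewrite mul1r mulrA mulVf ?gt_eqF// mul1r ler_piMr ?expR_ge0//.
by rewrite mulN1r -expR0 ler_expR oppr_le0.
Qed.

End Exp1.

(** * Two exponential clocks started at different times *)

Section Race.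
Local Open Scope classical_set_scope.
Local Open Scope ereal_scope.
Context {R : realType}.
Local Notation RR := (measurableTypeR R).

(** Two independent clocks that have run for [a] and [b] forget it: the residual
    times behave as fresh clocks, up to the probability of having survived. *)
Lemma integral_exp1_shift2 (a b : R) (phi : RR * RR -> bool) :
  (0 <= a)%R -> (0 <= b)%R -> measurable_fun setT phi ->
  \int[exp1]_x \int[exp1]_y
     ([&& a < x, b < y & phi (x - a, y - b)]%R%:R%:E : \bar R)
  = (expR (- a))%:E * ((expR (- b))%:E * \int[exp1]_x \int[exp1]_y
       ([&& 0 < x, 0 < y & phi (x, y)]%R%:R%:E : \bar R)).
Proof.
move=> a0 b0 mphi.
have mlt (c : R) d (T : measurableType d) (f : T -> RR) : measurable_fun setT f ->
    measurable_fun setT (fun x => (c < f x)%R).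
  by move=> mf; exact: measurable_fun_ltr.
pose F (xy : RR * RR) : \bar R := ((0 < xy.2)%R && phi xy)%:R%:E.
have mF : measurable_fun setT F.
  by apply: measurable_bool_EFin; apply: measurable_and => //; exact: mlt.
have F0 xy : 0 <= F xy by rewrite lee_fin.
pose h (x : RR) : \bar R := \int[exp1]_y F (x, y).
have mh : measurable_fun setT h by exact: measurable_fun_fubini_tonelli_F.
have h0 x : 0 <= h x by exact: integral_ge0.
have mphi1 x : measurable_fun setT (fun y => phi (x, y)).
  exact: measurable_fun_pair2.
have inner (c x : R) : \int[exp1]_y
    ([&& c < x, 0 < y & phi (x - c, y)]%R%:R%:E : \bar R)
    = (c < x)%R%:R%:E * h (x - c)%R.
  rewrite /h /F; case: (c < x)%R; last by rewrite integral0 mul0e.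
  by rewrite mul1e.
transitivity (\int[exp1]_x ((expR (- b))%:E *
    ((a < x)%R%:R%:E * h (x - a)%R))).
  apply: eq_integral => x _; rewrite -inner.
  transitivity (\int[exp1]_y ((b < y)%R%:R%:E *
     ((a < x)%R && phi (x - a, y - b))%R%:R%:E : \bar R)).
    apply: eq_integral => y _; rewrite -EFinM.
    by case: (a < x)%R; case: (b < y)%R; rewrite /= ?(mul1r, mul0r).
  rewrite (@integral_exp1_shift _ b
    (fun y => ((a < x)%R && phi (x - a, y))%R%:R%:E))//.
    congr (_ * _); apply: eq_integral => y _; rewrite -EFinM.
    by case: (a < x)%R; case: (0 < y)%R; rewrite /= ?(mul1r, mul0r).
  by apply: measurable_bool_EFin; apply: measurable_and => //; exact: mphi1.
rewrite ge0_integralZl//.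
- rewrite integral_exp1_shift// muleCA; congr (_ * (_ * _)).
  by apply: eq_integral => x _; have := inner 0%R x; rewrite subr0 => ->.
- apply: emeasurable_funM.
    by apply: measurable_bool_EFin; exact: mlt.
  apply: measurableT_comp => //; exact: measurable_funB.
- by move=> x _; rewrite mule_ge0.
Qed.

(** Two clocks that have survived until [a] and [b] have exchangeable residual
    times, so either one is equally likely to ring first, jointly with any event [C]
    about the residual time of the winner.  By lack of memory both sides are the
    same multiple of an integral in which the two clocks play symmetric roles. *)
Lemma exp1_race_sym (a b : R) (C : RR -> bool) :
  (0 <= a)%R -> (0 <= b)%R -> measurable_fun setT C ->
  \int[exp1]_x \int[exp1]_y
     ([&& a < x, b < y, x - a < y - b & C (x - a)]%R%:R%:E : \bar R)
  = \int[exp1]_x \int[exp1]_y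
     ([&& a < x, b < y, y - b < x - a & C (y - b)]%R%:R%:E : \bar R).
Proof.
move=> a0 b0 mC.
have mlt d (T : measurableType d) (f g : T -> RR) : measurable_fun setT f ->
    measurable_fun setT g -> measurable_fun setT (fun x => (f x < g x)%R).
  by move=> mf mg; exact: measurable_fun_ltr.
have mphi1 : measurable_fun setT (fun z : RR * RR => (z.1 < z.2)%R && C z.1).
  by apply: measurable_and; [exact: mlt | exact: measurableT_comp].
have mphi2 : measurable_fun setT (fun z : RR * RR => (z.2 < z.1)%R && C z.2).
  by apply: measurable_and; [exact: mlt | exact: measurableT_comp].
pose Phi (z : RR * RR) : \bar R :=
  [&& 0 < z.1, 0 < z.2, z.1 < z.2 & C z.1]%R%:R%:E.
have mPhi : measurable_fun setT Phi.
  apply: measurable_bool_EFin; do 2 (apply: measurable_and; first exact: mlt).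
  exact: mphi1.
have Phi0 z : 0 <= Phi z by rewrite lee_fin.
have swap : \int[exp1]_x \int[exp1]_y Phi (x, y) =
    \int[exp1]_x \int[exp1]_y
      ([&& 0 < x, 0 < y & (y < x) && C y]%R%:R%:E : \bar R).
  rewrite (fubini_tonelli (m1 := exp1) (m2 := exp1) Phi mPhi Phi0).
  apply: eq_integral => x _; apply: eq_integral => y _.
  by rewrite /Phi /= andbCA.
transitivity ((expR (- a))%:E * ((expR (- b))%:E *
    \int[exp1]_x \int[exp1]_y Phi (x, y))).
  exact: (integral_exp1_shift2 a0 b0 mphi1).
by rewrite swap; apply/esym/(integral_exp1_shift2 a0 b0 mphi2).
Qed.
End Race.

(** * Resampling one edge of independent passage times *)

Section WeightSpace.
Local Open Scope classical_set_scope.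
Context {R : realType} {I : finType}.
Implicit Types (A : {set I}) (t : I -> R).

(** Only the coordinates in [A] are constrained: the passage times of other
    indices are arbitrary, so the sigma-algebra must not see them. *)
Definition cylinder A (B : I -> set R) : set (I -> R) :=
  [set t | forall i, i \in A -> B i (t i)].

Definition cylinders A : set (set (I -> R)) :=
  [set C | exists2 B, (forall i, measurable (B i)) & C = cylinder A B].

Definition weights A := g_sigma_algebraType (cylinders A).

Lemma cylinderT A : cylinder A (fun=> setT) = setT.
Proof. by apply/seteqP; split. Qed.

Lemma measurable_coord A i : i \in A ->
  measurable_fun [set: weights A] (fun t => t i : R).
Proof.
move=> iA _ B mB; rewrite setTI; apply: sub_sigma_algebra.
exists (fun j => if j == i then B else setT); first by move=> j; case: ifP.
apply/seteqP; split=> t /=; last by move=> /(_ i iA); rewrite eqxx.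
by move=> Bt j jA; case: eqP => // ->.
Qed.

Lemma measurable_into_weights A d (T : measurableType d) (f : T -> weights A) :
  (forall i, i \in A -> measurable_fun setT (fun x => f x i : R)) ->
  measurable_fun setT f.
Proof.
move=> mf; apply: (@measurability _ _ T (weights A) setT f (cylinders A) erefl).
move=> _ [_ [B mB ->] <-].
rewrite setTI (_ : f @^-1` _ =
    \bigcap_(i in [set` A]) (fun x => f x i : R) @^-1` B i)//.
apply: fin_bigcap_measurable => // i /= iA.
by rewrite -[X in measurable X]setTI; exact: mf.
Qed.

Definition upd t (i : I) (x : R) : I -> R := fun j => if j == i then x else t j.

Lemma measurable_upd A d (T : measurableType d) (f : T -> weights A)
    (x : T -> R) i :
  measurable_fun setT f -> measurable_fun setT x ->
  measurable_fun setT (fun z => upd (f z) i (x z) : weights A).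
Proof.
move=> mf mx; apply: measurable_into_weights => j jA; rewrite /upd /=.
case: (j == i) => //; exact: (measurableT_comp (measurable_coord jA)).
Qed.

(** Independence in the form in which it is used: redrawing one coordinate from
    the exponential law does not change the law of the whole family. *)
Definition resampling A (mu : {measure set (weights A) -> \bar R}) : Prop :=
  forall i, i \in A -> forall F : weights A -> \bar R,
    measurable_fun setT F -> (forall t, 0 <= F t)%E ->
  (\int[mu]_t F t = \int[mu]_t \int[exp1]_x F (upd t i x))%E.

Lemma setI_closed_cylinders A : setI_closed (cylinders A).
Proof.
move=> _ _ [B mB ->] [C mC ->]; exists (fun i => B i `&` C i).
  by move=> i; exact: measurableI.
apply/seteqP; split=> t /=; first by move=> [Bt Ct] i iA; split; auto.
by move=> BCt; split=> i /BCt[].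
Qed.

Context d (Omega : measurableType d) (P : probability Omega R).
Variables (A : {set I}) (X : I -> {RV P >-> R}).
Hypothesis X_indep : mutually_independent A X.
Hypothesis X_exp : forall i, i \in A -> forall B : set R, measurable B ->
  distribution P (X i) B = exponential_prob 1 B.

Definition sample (w : Omega) : weights A := fun i => X i w.

Lemma measurable_sample : measurable_fun setT sample.
Proof. by apply: measurable_into_weights => i _; exact: measurable_funP. Qed.

HB.instance Definition _ :=
  isMeasurableFun.Build _ _ _ _ sample measurable_sample.

Lemma cylinder_indep (J : {set I}) B : J \subset A ->
  (forall i, measurable (B i)) ->
  P [set w | forall i, i \in J -> B i (X i w)]
  = (\prod_(i in J) exponential_prob 1 (B i))%E.
Proof.
move=> JA mB; rewrite (_ : [set w | _] = \bigcap_(i in [set` J]) (X i @^-1` B i))//.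
rewrite X_indep//; apply: eq_bigr => i iJ.
by rewrite -(X_exp (fintype.subsetP JA _ iJ)).
Qed.

(** The law of the family and the law of its resampled version are finite measures
    that agree on cylinders by independence, and cylinders are stable under
    intersection and generate the sigma-algebra. *)
Lemma resampling_law : resampling (distribution P sample).
Proof.
move=> i iA F mF F0.
have mPhi : measurable_fun setT
    (fun z : Omega * measurableTypeR R => upd (sample z.1) i z.2 : weights A).
  apply: measurable_upd => //.
  exact: (measurableT_comp measurable_sample).
transitivity (\int[(P \x exp1)%E]_z F (upd (sample z.1) i z.2))%E.
  rewrite -[RHS](@ge0_integral_pushforward _ _ _ _ _ _ mPhi (P \x exp1)%E setT F)//.
  apply: eq_measure_integral => B mB _.
  apply: (@measure_unique _ _ (weights A) (cylinders A) (fun=> setT) erefl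
    _ _ _ _ _ _ _ B) => //.
  - exact: setI_closed_cylinders.
  - by move=> _; exists (fun=> setT) => //; rewrite cylinderT.
  - by rewrite bigcup_const.
  - move=> _ [C mC ->].
    rewrite /= /distribution /pushforward.
    rewrite [LHS](cylinder_indep (subxx A) mC) (bigD1 i)//=.
    rewrite (_ : _ @^-1` _ =
       [set w | forall j, j \in (A :\ i)%SET -> C j (X j w)] `*` C i); last first.
      apply/seteqP; split=> -[w x] /=.
        move=> AC; split; last by have := AC i iA; rewrite /upd eqxx.
        by move=> j /setD1P[/negbTE ji jA]; have := AC j jA; rewrite /upd ji.
      move=> [AC Cx] j jA; rewrite /upd; case: eqP => [->//|/eqP ji].
      by apply: AC; rewrite !inE ji.
    have mD : measurable [set w : Omega | forall j, j \in (A :\ i)%SET -> C j (X j w)].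
      rewrite (_ : [set w | _] =
         \bigcap_(j in [set` (A :\ i)%SET]) (X j @^-1` C j))//.
      apply: fin_bigcap_measurable => // j _.
      by rewrite -[X in measurable X]setTI; exact: measurable_funP.
    have mCi : measurable (C i : set (measurableTypeR R)) by exact: mC.
    rewrite [RHS](product_measure1E P exp1 mD mCi).
    rewrite [X in _ = (X * _)%E](cylinder_indep (subsetDl A [set i]%SET) mC).
    rewrite muleC; congr (_ * _)%E.
    by apply: eq_bigl => j; rewrite !inE andbC.
  - by move=> _; rewrite [X in (X < _)%E]probability_setT ltry.
rewrite (fubini_tonelli1 (m1 := P) (m2 := exp1) _ (measurableT_comp mF mPhi))//.
rewrite ge0_integral_pushforward// ?preimage_setT//.
- apply: (measurable_fun_fubini_tonelli_F (m2 := exp1)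
    (fun z : weights A * measurableTypeR R => F (upd z.1 i z.2))) => //.
  by apply: (measurableT_comp mF); exact: (measurable_upd i measurable_fst measurable_snd).
- by move=> t _; exact: integral_ge0.
- by move=> z; exact: F0.
Qed.

End WeightSpace.

(** * Exploration of a graph along a history of edges *)

Section Exploration.
Variables (R : realType) (V : finType) (E : rel V) (s : V).
Hypotheses (E_sym : symmetric E) (E_irr : irreflexive E).
Implicit Types (t : {set V} -> R) (f g : {set V}) (fs : seq {set V}).

Definition grown fs : subgraph V :=
  foldr (fun f T => add_edge T f) (tree_start s) fs.

Definition boundary fs : {set {set V}} := out_edges E (grown fs).

(** Edge lists are kept with the most recent edge at the head, so that dropping
    the head is going back one step in time. *)
Fixpoint history fs : bool :=
  if fs is f :: fs' then (f \in boundary fs') && history fs' else true.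

(** The endpoint of a boundary edge that lies in the tree; the default [s] is never
    reached for a boundary edge. *)
Definition gate fs f : V := odflt s [pick x in f :&: (grown fs).1].

(** Meaningful on the vertices of the grown tree only. *)
Fixpoint birth t fs (v : V) : R :=
  if fs is f :: fs' then
    if v \in (grown fs').1 then birth t fs' v else birth t fs' (gate fs' f) + t f
  else 0.

Definition arrival t fs f : R := birth t fs (gate fs f) + t f.

(** The time at which the last edge was added. *)
Definition clock t fs : R := if fs is f :: fs' then arrival t fs' f else 0.

(** The part of [explored] that depends only on edges inside the grown tree.  An
    edge is tested against the winner [f] here when adding [f] puts both of its
    endpoints into the tree; edges that stay on the boundary are left to
    [explored]. *)
Fixpoint inner t fs : bool :=
  if fs is f :: fs' then
    [&& inner t fs', clock t fs' < arrival t fs' f &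
        [forall g in boundary fs', (g != f) && (g \subset (grown fs).1) ==>
           (arrival t fs' f < arrival t fs' g)]]
  else true.

(** Every boundary edge has survived until the present time.  Keeping this separate
    from [inner] isolates the dependence on boundary edges, which is what lack of
    memory acts on. *)
Definition explored t fs : bool :=
  inner t fs && [forall f in boundary fs, clock t fs < arrival t fs f].

Definition arrives_first t fs f : bool :=
  [forall g in boundary fs, (g != f) ==> (arrival t fs f < arrival t fs g)].

Lemma out_edgeP (T : subgraph V) f : f \in out_edges E T ->
  exists u v, [/\ f = [set u; v]%SET, u \in T.1, v \notin T.1 & E u v].
Proof.
rewrite inE => /andP[/imsetP[[x y]]]; rewrite inE /= => Exy -> /eqP xyT.
have yx : y != x by apply: contraTneq Exy => ->; rewrite E_irr.
have card_xy : #|[set x; y]%SET| = 2 by rewrite cards2 eq_sym yx.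
case xT: (x \in T.1); case yT: (y \in T.1).
- move: xyT; rewrite (finset.setIidPl _) ?card_xy//.
  by apply/fintype.subsetP => z /set2P[]->.
- by exists x, y; rewrite xT yT.
- by exists y, x; rewrite xT yT finset.setUC E_sym.
- move: xyT; rewrite (_ : _ :&: _ = finset.set0)%SET ?cards0//.
  by apply/setP => z; rewrite !inE; apply/andP => -[/orP[]/eqP->]; rewrite ?xT ?yT.
Qed.

Lemma mem_out_edges (T : subgraph V) u v : E u v -> u \in T.1 -> v \notin T.1 ->
  [set u; v]%SET \in out_edges E T.
Proof.
move=> Euv uT vT; rewrite inE; apply/andP; split.
  by apply/imsetP; exists (u, v); rewrite ?inE.
apply/eqP; rewrite -(cards1 u); congr #|pred_of_set _|; apply/setP => z.
rewrite !inE; apply/andP/eqP => [[/orP[]/eqP-> //]|->]; last by rewrite eqxx.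
by rewrite (negbTE vT).
Qed.

Lemma out_edge_not_subset (T : subgraph V) f : f \in out_edges E T -> ~~ (f \subset T.1).
Proof.
move=> /out_edgeP[u [v [-> _ vT _]]]; apply/subsetPn; exists v => //.
by rewrite !inE eqxx orbT.
Qed.

Lemma boundary_edges fs f : f \in boundary fs -> f \in edges E.
Proof. by rewrite inE => /andP[]. Qed.

Lemma gateE fs u v : u \in (grown fs).1 -> v \notin (grown fs).1 ->
  gate fs [set u; v]%SET = u.
Proof.
move=> uT vT; rewrite /gate; case: pickP => [x|/(_ u)]; last first.
  by rewrite !inE eqxx uT.
by rewrite !inE => /andP[/orP[]/eqP-> //]; rewrite (negbTE vT).
Qed.

Lemma gate_mem fs f : f \in boundary fs -> gate fs f \in (grown fs).1.
Proof. by move=> /out_edgeP[u [v [-> uT vT _]]]; rewrite gateE. Qed.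

Lemma grown_sub fs f : (grown fs).1 \subset (grown (f :: fs)).1.
Proof. exact: finset.subsetUl. Qed.

Lemma root_grown fs : s \in (grown fs).1.
Proof.
elim: fs => [|f fs IH]; first by rewrite /= inE.
exact: (fintype.subsetP (grown_sub fs f)).
Qed.

Lemma grown_cons fs u v : u \in (grown fs).1 ->
  (grown ([set u; v]%SET :: fs)).1 = (v |: (grown fs).1)%SET.
Proof.
move=> uT /=; apply/setP => z; rewrite !inE.
by case: (z =P u) => [->|_]; rewrite ?uT ?orbT// orbC.
Qed.

Lemma birth_old t fs f v : v \in (grown fs).1 -> birth t (f :: fs) v = birth t fs v.
Proof. by move=> /= ->. Qed.

Lemma birth_new t fs f v : v \notin (grown fs).1 ->
  birth t (f :: fs) v = arrival t fs f.
Proof. by move=> /= /negbTE->. Qed.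

Lemma arrival_old t fs f g : g \in boundary fs -> g \in boundary (f :: fs) ->
  arrival t (f :: fs) g = arrival t fs g.
Proof.
move=> /out_edgeP[u [v [-> uT vT _]]].
have uT' : u \in (grown (f :: fs)).1 by exact: (fintype.subsetP (grown_sub fs f)).
move=> g_out; have vT' : v \notin (grown (f :: fs)).1.
  apply: contra (out_edge_not_subset g_out) => vT'.
  by apply/fintype.subsetP => z /set2P[]->.
by rewrite /arrival !gateE// birth_old.
Qed.

Lemma card_grown fs : history fs -> #|(grown fs).1| = (size fs).+1.
Proof.
elim: fs => [|f fs IH] /=; first by rewrite cards1.
move=> /andP[/out_edgeP[u [v [-> uT vT _]]] /IH cT].
by have := grown_cons v uT => /= ->; rewrite cardsU1 vT cT.
Qed.

Lemma grown_edges fs f : history fs -> f \in (grown fs).2 ->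
  (f \in edges E) && (f \subset (grown fs).1).
Proof.
elim: fs => [|g fs IH]; first by rewrite inE.
move=> /andP[g_out /IH{}IH]; rewrite in_setU1 => /predU1P[->|/IH /andP[-> fT]].
  by rewrite (boundary_edges g_out) finset.subsetUr.
by rewrite (fintype.subset_trans fT)// grown_sub.
Qed.

(** The past of the exploration does not look at boundary edges, so they can be
    resampled. *)
Lemma locality t t' fs : history fs ->
  (forall f, f \in edges E -> f \subset (grown fs).1 -> t f = t' f) ->
  [/\ forall v, v \in (grown fs).1 -> birth t fs v = birth t' fs v,
      clock t fs = clock t' fs & inner t fs = inner t' fs].
Proof.
elim: fs => [//|f fs IH] /andP[f_out hfs] tt'.
have [|bE cE iE] := IH hfs.
  by move=> g gE gT; apply: tt' => //; rewrite (fintype.subset_trans gT)// grown_sub.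
have aE g : g \in boundary fs -> g \subset (grown (f :: fs)).1 ->
    arrival t fs g = arrival t' fs g.
  move=> g_out gT; rewrite /arrival bE ?gate_mem// tt'//.
  exact: boundary_edges g_out.
have afE : arrival t fs f = arrival t' fs f by rewrite aE// finset.subsetUr.
split.
- move=> v _; case: (boolP (v \in (grown fs).1)) => vT; last by rewrite !birth_new.
  by rewrite !birth_old// bE.
- exact: afE.
- rewrite /= iE cE afE; congr [&& _, _ & _]; apply: eq_forallb_in => g g_out.
  by apply: implyb_id2l => /andP[_ gT]; rewrite aE.
Qed.

Lemma explored_arrives_first t fs f : history (f :: fs) -> explored t (f :: fs) ->
  explored t fs && arrives_first t fs f.
Proof.
move=> /andP[f_out hfs] /andP[/and3P[ifs ltf /forall_inP innf] /forall_inP exf].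
have firstP g : g \in boundary fs -> g != f -> arrival t fs f < arrival t fs g.
  move=> g_out gf; case: (boolP (g \subset (grown (f :: fs)).1)) => gT.
    by have /implyP := innf g g_out; apply; rewrite gf.
  have g_out' : g \in boundary (f :: fs).
    have [u [v [gE uT vT Euv]]] := out_edgeP g_out; rewrite gE.
    have uT' : u \in (grown (f :: fs)).1.
      exact: (fintype.subsetP (grown_sub fs f)).
    apply: mem_out_edges => //; apply: contra gT => vT'; rewrite gE.
    by apply/fintype.subsetP => z /set2P[]->.
  by rewrite -(arrival_old _ g_out g_out'); exact: exf.
apply/andP; split; last first.
  by apply/forall_inP => g g_out; apply/implyP; exact: firstP.
apply/andP; split; first exact: ifs.
apply/forall_inP => g g_out; have [->//|gf] := eqVneq g f.
by rewrite (lt_trans ltf)// firstP.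
Qed.

(** The only boundary edges that are new after adding [f] start at the vertex born
    at the present time, so they survive as soon as their passage time is positive. *)
Lemma explored_cons t fs f : (forall g, g \in edges E -> 0 < t g) ->
  f \in boundary fs -> explored t fs -> arrives_first t fs f -> explored t (f :: fs).
Proof.
move=> t0 f_out /andP[ifs /forall_inP exf] /forall_inP firstf.
apply/andP; split.
  apply/and3P; split=> //; first exact: exf.
  apply/forall_inP => g g_out; apply/implyP => /andP[gf _].
  by have /implyP := firstf g g_out; apply.
apply/forall_inP => g g_out; have := g_out.
have /out_edgeP[u [v [gE uT vT Euv]]] := g_out.
have vT' : v \notin (grown fs).1.
  by apply: contra vT; exact: (fintype.subsetP (grown_sub fs f)).
case: (boolP (u \in (grown fs).1)) => uT' _.
  have g_out' : g \in boundary fs by rewrite gE mem_out_edges.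
  rewrite (arrival_old _ g_out' g_out).
  have /implyP := firstf g g_out'; apply.
  apply: contraNneq vT => gf; apply: (fintype.subsetP (finset.subsetUr _ f)).
  by rewrite -gf gE !inE eqxx orbT.
rewrite [X in _ < X]/arrival gE gateE// birth_new// ltrDl -gE.
by rewrite t0// (boundary_edges g_out).
Qed.

Lemma birth_le_clock t fs v : history fs -> inner t fs -> v \in (grown fs).1 ->
  birth t fs v <= clock t fs.
Proof.
elim: fs v => [//|f fs IH] v /andP[f_out hfs] /and3P[ifs ltf _] vT.
have [vT'|vT'] := boolP (v \in (grown fs).1); last by rewrite birth_new.
by rewrite birth_old// (le_trans (IH _ hfs ifs vT'))// ltW.
Qed.

Definition rivals fs f g : {set {set V}} := (boundary fs :\: [set f; g])%SET.

(** The form of the event that fits [exp1_race_sym]: the passage times of [f] and [g]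
    enter only through a race between clocks that have run for [a] and [b].  The
    rest depends on the other edges, and the set of rivals is symmetric in [f]
    and [g]. *)
Lemma race_event t t' fs f g : history fs ->
  f \in boundary fs -> g \in boundary fs -> f != g ->
  (forall h, h != f -> h != g -> t' h = t h) ->
  let a := clock t fs - birth t fs (gate fs f) in
  let b := clock t fs - birth t fs (gate fs g) in
  explored t' fs && arrives_first t' fs f =
  [&& inner t fs && [forall h in rivals fs f g, clock t fs < arrival t fs h],
      a < t' f, b < t' g, t' f - a < t' g - b &
      [forall h in rivals fs f g, t' f - a < arrival t fs h - clock t fs]].
Proof.
move=> hfs f_out g_out fg t't a b.
have [|bE cE iE] := @locality t' t fs hfs.
  move=> h hE hT; apply: t't; apply: contraTneq hT => ->; exact: out_edge_not_subset.
have arrE h : h \in boundary fs ->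
    arrival t' fs h = birth t fs (gate fs h) + t' h.
  by move=> h_out; rewrite /arrival bE// gate_mem.
have rivE h : h \in rivals fs f g -> arrival t' fs h = arrival t fs h.
  rewrite !inE negb_or => /andP[/andP[hf hg] h_out].
  by rewrite arrE ?inE// t't.
have rivP h : h \in boundary fs -> [\/ h = f, h = g | h \in rivals fs f g].
  move=> h_out; have [->|hf] := eqVneq h f; first exact: Or31.
  have [->|hg] := eqVneq h g; first exact: Or32.
  by apply: Or33; rewrite finset.in_setD in_set2 (negbTE hf) (negbTE hg).
have riv_out h : h \in rivals fs f g -> h \in boundary fs.
  by rewrite finset.in_setD => /andP[].
have riv_f h : h \in rivals fs f g -> h != f.
  by rewrite finset.in_setD !inE negb_or => /andP[/andP[]].
rewrite /explored iE cE; apply/idP/idP.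
  move=> /andP[/andP[-> /forall_inP exP] /forall_inP fiP] /=.
  have := exP _ f_out; have := exP _ g_out; rewrite !arrE// => ltg ltf.
  apply/and5P; split.
  - by apply/forall_inP => h hr; rewrite -rivE// exP// riv_out.
  - by rewrite /a ltrBlDl.
  - by rewrite /b ltrBlDl.
  - have /implyP := fiP _ g_out; rewrite eq_sym fg !arrE// => /(_ isT).
    rewrite /a /b; lra.
  - apply/forall_inP => h hr; have /implyP := fiP _ (riv_out _ hr).
    rewrite riv_f// (rivE h)// arrE// => /(_ isT); rewrite /a; lra.
move=> /and5P[/andP[-> /forall_inP hclk] af bg fg' /forall_inP hC] /=.
apply/andP; split; apply/forall_inP => h h_out.
  have [->|->|hr] := rivP h h_out.
  - by rewrite arrE// -ltrBlDl.
  - by rewrite arrE// -ltrBlDl.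
  - by rewrite rivE// hclk.
apply/implyP => hf; have [hf'|->|hr] := rivP h h_out.
- by rewrite hf' eqxx in hf.
- by rewrite !arrE//; move: fg'; rewrite /a /b; lra.
- by rewrite (rivE h)// arrE//; have := hC _ hr; rewrite /a; lra.
Qed.

End Exploration.

(** * Paths, birth times and the shape of the explored tree *)

Section Paths.
Variables (R : realType) (V : finType) (E : rel V) (s : V).
Hypotheses (E_sym : symmetric E) (E_irr : irreflexive E).
Implicit Types (t : {set V} -> R) (f g : {set V}) (fs : seq {set V}) (q : seq V).

Lemma path_time_cons t x y q :
  path_time t x (y :: q) = t [set x; y]%SET + path_time t y q.
Proof. by rewrite /path_time /= big_cons. Qed.

Lemma path_time_cat t x q1 q2 :
  path_time t x (q1 ++ q2) = path_time t x q1 + path_time t (last x q1) q2.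
Proof.
elim: q1 x => [|y q1 IH] x /=; first by rewrite [X in X + _]big_nil add0r.
by rewrite !path_time_cons IH addrA.
Qed.

Lemma path_edge_mem x y : E x y -> [set x; y]%SET \in edges E.
Proof. by move=> Exy; apply/imsetP; exists (x, y); rewrite ?inE. Qed.

Lemma path_time_ge0 t x q : (forall f, f \in edges E -> 0 <= t f) ->
  path E x q -> 0 <= path_time t x q.
Proof.
move=> t0; elim: q x => [|y q IH] x /=; first by rewrite /path_time big_nil.
by move=> /andP[Exy pq]; rewrite path_time_cons addr_ge0 ?IH// t0// path_edge_mem.
Qed.

Lemma path_exit (S : {set V}) x q : path E x q -> x \in S -> last x q \notin S ->
  exists q1 y q2, [/\ q = q1 ++ y :: q2, last x q1 \in S & y \notin S].
Proof.
elim: q x => [x _ -> //|y q IH] x /= /andP[Exy pq] xS lS.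
have [yS|yS] := boolP (y \in S); last by exists [::], y, q.
by have [q1 [z [q2 [-> ? ?]]]] := IH y pq yS lS; exists (y :: q1), z, q2.
Qed.

(** Dijkstra's argument: a path to the newest vertex leaves the older tree through
    some boundary edge, and that edge does not arrive before the winner. *)
Lemma birth_le_path_time t fs q : (forall f, f \in edges E -> 0 <= t f) ->
  history E s fs -> explored E s t fs -> path E s q -> last s q \in (grown s fs).1 ->
  birth s t fs (last s q) <= path_time t s q.
Proof.
move=> t0; elim: fs q => [|f fs IH] q; first by move=> _ _ /(path_time_ge0 t0).
move=> hffs exf pq lq; have /andP[f_out hfs] := hffs.
have /andP[exfs /forall_inP firstf] := explored_arrives_first E_sym E_irr hffs exf.
have [lq'|lq'] := boolP (last s q \in (grown s fs).1).
  by rewrite birth_old// IH.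
rewrite birth_new//.
have [q1 [y [q2 [qE q1T yT]]]] := path_exit pq (root_grown s fs) lq'.
move: pq; rewrite qE cat_path /= => /and3P[pq1 Ey pq2].
rewrite path_time_cat path_time_cons addrA.
pose g := [set last s q1; y]%SET.
have g_out : g \in boundary E s fs by exact: mem_out_edges.
apply: (@le_trans _ _ (arrival s t fs g)).
  have [->//|gf] := eqVneq g f.
  by apply: ltW; have /implyP := firstf g g_out; apply.
rewrite /arrival gateE// -[X in X <= _]addr0 lerD ?path_time_ge0// lerD2r.
exact: IH.
Qed.

Lemma tree_path_mem fs q : history E s fs -> path (adjacent_in (grown s fs)) s q ->
  {subset s :: q <= (grown s fs).1}.
Proof.
move=> hfs; suff sub x : x \in (grown s fs).1 -> path (adjacent_in (grown s fs)) x q ->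
  {subset x :: q <= (grown s fs).1} by exact: (sub _ (root_grown s fs)).
elim: q x => [x xT _ y|y q IH x xT] /=; first by rewrite inE => /eqP->.
move=> /andP[xy pq] z; rewrite inE => /predU1P[->//|]; apply: (IH y _ pq).
have /andP[_ /fintype.subsetP] := grown_edges hfs xy.
by apply; rewrite !inE eqxx orbT.
Qed.

(** The newest vertex is a leaf of the tree, so a simple path from the root can visit
    it only at its end, and it enters it through the newest edge. *)
Lemma tree_path_time t fs q : history E s fs ->
  simple_path (adjacent_in (grown s fs)) s q ->
  path_time t s q = birth s t fs (last s q).
Proof.
elim: fs q => [|f fs IH] q.
  case: q => [|y q]; first by rewrite /path_time big_nil.
  by rewrite /simple_path /= /adjacent_in /= inE.
move=> hffs /andP[pq uq]; have /andP[f_out hfs] := hffs.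
have [u [v [fE uT vT _]]] := out_edgeP E_sym E_irr f_out.
have sv : s != v by apply: contraNneq vT => <-; exact: root_grown.
have old x y : x != v -> y != v -> adjacent_in (grown s (f :: fs)) x y ->
    adjacent_in (grown s fs) x y.
  move=> xv yv; rewrite /adjacent_in /= in_setU1 => /predU1P[xyf|//].
  have : v \in [set x; y]%SET by rewrite xyf fE !inE eqxx orbT.
  by rewrite !inE eq_sym (negbTE xv) eq_sym (negbTE yv).
have oldpath x p : x != v -> v \notin p -> path (adjacent_in (grown s (f :: fs))) x p ->
    path (adjacent_in (grown s fs)) x p.
  elim: p x => [//|y p IHp] x xv /=; rewrite inE negb_or eq_sym.
  by move=> /andP[yv vp] /andP[xy pp]; apply/andP; split; [exact: old | exact: IHp].
have nbr x : adjacent_in (grown s (f :: fs)) x v -> x = u.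
  rewrite /adjacent_in /= in_setU1 => /predU1P[xvf|].
    have : x \in f by rewrite -xvf !inE eqxx.
    rewrite fE !inE => /orP[/eqP//|/eqP xv].
    have : u \in [set x; v]%SET by rewrite xvf fE !inE eqxx.
    by rewrite xv !inE orbb => /eqP uv; rewrite uv (negbTE vT) in uT.
  move=> /(grown_edges hfs)/andP[_ /fintype.subsetP/(_ v)].
  by rewrite (negbTE vT) !inE eqxx orbT => /(_ isT).
have [vq|vq] := boolP (v \in q); last first.
  have pq' := oldpath _ _ sv vq pq.
  have lT := tree_path_mem hfs pq' (mem_last s q).
  by rewrite birth_old// IH// /simple_path pq'.
case/splitPr: vq pq uq => q1 q2; rewrite -cat_cons cat_uniq => pq uq.
have /and3P[pq1 /nbr q1u pq2] : [&& path (adjacent_in (grown s (f :: fs))) s q1,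
    adjacent_in (grown s (f :: fs)) (last s q1) v &
    path (adjacent_in (grown s (f :: fs))) v q2] by rewrite cat_path in pq.
clear pq.
rewrite last_cat last_cons.
case: q2 pq2 uq => [_ uq|z q2 /andP[vz _] uq]; last first.
  have zu : z = u by apply: nbr; rewrite /adjacent_in finset.setUC.
  have : u \in s :: q1 by rewrite -q1u mem_last.
  case/and3P: uq => _ /hasPn/(_ u) uq _; rewrite (negbTE (uq _))//.
  by rewrite zu !inE eqxx orbT.
move: uq; rewrite [has _ _]/= orbF => /and3P[uq1 vq1 _].
have vq1' : v \notin q1 by apply: contra vq1; rewrite inE => ->; rewrite orbT.
have pq1' := oldpath _ _ sv vq1' pq1.
rewrite path_time_cat path_time_cons {2}/path_time big_nil addr0 birth_new//.
by rewrite q1u -fE /arrival fE gateE// -fE -{1}q1u IH// /simple_path pq1'.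
Qed.

Lemma birth_le_cover_time t fs v : (forall f, f \in edges E -> 0 <= t f) ->
  history E s fs -> explored E s t fs -> v \in (grown s fs).1 ->
  ((birth s t fs v)%:E <= cover_time E t s)%E.
Proof.
move=> t0 hfs exfs vT.
apply: (@le_trans _ _ (passage_time E t s v)); last first.
  exact: le_bigmax.
apply/bigmin_geP; split => [|q /andP[/andP[pq _] /eqP lq]]; first exact: leey.
by rewrite lee_fin -lq; apply: birth_le_path_time; rewrite ?lq.
Qed.

Lemma fast_path t fs (L : nat) (K : R) : (forall f, f \in edges E -> 0 <= t f) ->
  history E s fs -> explored E s t fs -> (cover_time E t s <= K%:E)%E ->
  (L < height s (grown s fs))%N ->
  exists2 q : L.-tuple V, simple_path E s q & path_time t s q <= K.
Proof.
move=> t0 hfs exfs covK tall.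
have [q /andP[sq _] Lq] : exists2 q : #|V|.-bseq V,
    simple_path (adjacent_in (grown s fs)) s q && is_leaf s (grown s fs) (last s q)
    & (L < size q)%N.
  apply/exists_inP; apply: contraLR tall => /exists_inPn noq; rewrite -leqNgt.
  by apply/bigmax_leqP => q qP; rewrite leqNgt noq.
have Lq' : size (take L q) == L by rewrite size_take Lq.
have sq' : simple_path (adjacent_in (grown s fs)) s (take L q).
  case/andP: sq => pq uq; apply/andP; split; first exact: take_path.
  by have := take_uniq L.+1 uq.
exists (Tuple Lq') => /=.
  case/andP: sq' => pq' uq'; rewrite /simple_path uq' andbT.
  apply: sub_path pq' => x y; rewrite /adjacent_in => /(grown_edges hfs)/andP[+ _].
  move=> /imsetP[[a b]]; rewrite inE /= => Eab xyab.
  have ab : a != b by apply: contraTneq Eab => ->; rewrite E_irr.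
  have xy : x != y.
    apply: contraNneq ab => xy.
    have : #|[set x; y]%SET| = #|[set a; b]%SET| by rewrite xyab.
    by rewrite !cards2 xy eqxx; case: (a == b).
  have : x \in [set a; b]%SET by rewrite -xyab !inE eqxx.
  have : y \in [set a; b]%SET by rewrite -xyab !inE eqxx orbT.
  rewrite !inE => /orP[]/eqP yE /orP[]/eqP xE; rewrite yE xE ?eqxx // in xy *.
  by rewrite E_sym.
rewrite (tree_path_time t hfs sq') -lee_fin (le_trans _ covK)//.
apply: birth_le_cover_time => //; case/andP: sq' => pq' _.
exact: (tree_path_mem hfs pq' (mem_last _ _)).
Qed.

Fixpoint histories (k : nat) : seq (seq {set V}) :=
  if k is j.+1 then
    [seq f :: fs | fs <- histories j, f <- enum (boundary E s fs)]
  else [:: [::]].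

Lemma historiesP k fs : fs \in histories k -> history E s fs /\ size fs = k.
Proof.
elim: k fs => [|k IH] fs; first by rewrite inE => /eqP->.
case/allpairsPdep => fs' [f [/IH[hfs' <-]]]; rewrite mem_enum => f_out ->.
by rewrite /= f_out.
Qed.

(** A path from [s] to a vertex outside the tree must leave the tree. *)
Lemma boundary_neq0 fs : (forall x y, connect E x y) -> history E s fs ->
  ((size fs).+1 < #|V|)%N -> boundary E s fs != finset.set0.
Proof.
move=> E_conn hfs small.
have /subsetPn[v _ vT] : ~~ ([set: V]%SET \subset (grown s fs).1).
  apply/negP => /subset_leq_card; rewrite cardsT (card_grown E_sym E_irr hfs).
  by rewrite leqNgt small.
have /connectP[q pq lq] := E_conn s v; rewrite lq in vT.
have [q1 [y [q2 [qE q1T yT]]]] := path_exit pq (root_grown s fs) vT.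
move: pq; rewrite qE cat_path /= => /and3P[_ Ey _].
by apply/finset.set0Pn; exists [set last s q1; y]%SET; exact: mem_out_edges.
Qed.

(** The tree grows along the edge that arrives first, which is unique without
    ties. *)
Lemma explored_exists t k : (forall x y, connect E x y) ->
  (forall f, f \in edges E -> 0 < t f) ->
  (forall j fs f g, (j < #|V|)%N -> fs \in histories j ->
     f \in boundary E s fs -> g \in boundary E s fs ->
     f != g -> arrival s t fs f != arrival s t fs g) ->
  (k < #|V|)%N -> exists2 fs, fs \in histories k & explored E s t fs.
Proof.
move=> E_conn t0 notie; elim: k => [|k IH] kV.
  exists [::]; rewrite ?inE//; apply/andP; split=> //.
  apply/forall_inP => f f_out; rewrite /arrival /= add0r t0//.
  exact: boundary_edges f_out.
have [fs fsk exfs] := IH (ltnW kV); have [hfs sz] := historiesP fsk.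
have /finset.set0Pn[f0 f0_out] : boundary E s fs != finset.set0.
  by apply: boundary_neq0 => //; rewrite sz.
pose f := [arg min_(f < f0 in boundary E s fs) arrival s t fs f]%O.
have [f_out fmin] : f \in boundary E s fs /\ forall g, g \in boundary E s fs ->
    arrival s t fs f <= arrival s t fs g.
  by rewrite /f; case: Order.TotalTheory.arg_minP.
exists (f :: fs).
  by apply/allpairsPdep; exists fs, f; rewrite mem_enum.
apply: explored_cons => //.
apply/forall_inP => g g_out; apply/implyP => gf.
by rewrite lt_neqAle fmin// andbT (notie k)// 1?eq_sym// ltnW.
Qed.

End Paths.

(** * Measurability of the exploration *)

Section Measurability.
Local Open Scope classical_set_scope.
Context {R : realType} {V : finType} (E : rel V) (s : V).
Context d (Z : measurableType d) (tz : Z -> {set V} -> R).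
Hypothesis mt : forall f, f \in edges E -> measurable_fun setT (tz ^~ f).

Lemma measurable_forall_in (I : finType) (S : {set I}) (b : I -> Z -> bool) :
  (forall i, i \in S -> measurable_fun setT (b i)) ->
  measurable_fun setT (fun z => [forall i in S, b i z]).
Proof.
move=> mb; apply: (measurable_fun_bool true) => //.
rewrite setTI (_ : _ @^-1` _ = \bigcap_(i in [set` S]) (b i @^-1` [set true])).
  apply: fin_bigcap_measurable => // i /= iS.
  by rewrite -[X in measurable X]setTI; exact: mb.
apply/seteqP; split=> z /=; first by move=> /forall_inP bz i /= /bz.
by move=> bz; apply/forall_inP => i iS; exact: bz.
Qed.

Lemma measurable_birth fs v : history E s fs ->
  measurable_fun setT (fun z => birth s (tz z) fs v).
Proof.
elim: fs v => [|f fs IH] v /=; first by move=> _; exact: measurable_cst.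
move=> /andP[f_out hfs]; case: (v \in _); first exact: IH.
by apply: measurable_funD; [exact: IH | exact: mt (boundary_edges f_out)].
Qed.

Lemma measurable_arrival fs f : history E s fs -> f \in boundary E s fs ->
  measurable_fun setT (fun z => arrival s (tz z) fs f).
Proof.
move=> hfs f_out; apply: measurable_funD; first exact: measurable_birth.
exact: mt (boundary_edges f_out).
Qed.

Lemma measurable_clock fs : history E s fs ->
  measurable_fun setT (fun z => clock s (tz z) fs).
Proof.
case: fs => [|f fs] /=; first by move=> _; exact: measurable_cst.
by move=> /andP[f_out hfs]; exact: measurable_arrival.
Qed.

Lemma measurable_arrives_first fs f : history E s fs -> f \in boundary E s fs ->
  measurable_fun setT (fun z => arrives_first E s (tz z) fs f).
Proof.
move=> hfs f_out; apply: measurable_forall_in => g g_out.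
case: (g != f) => /=; last exact: measurable_cst.
by apply: measurable_fun_ltr; exact: measurable_arrival.
Qed.

Lemma measurable_inner fs : history E s fs ->
  measurable_fun setT (fun z => inner E s (tz z) fs).
Proof.
elim: fs => [|f fs IH] /=; first by move=> _; exact: measurable_cst.
move=> /andP[f_out hfs]; apply: measurable_and; first exact: IH.
apply: measurable_and.
  by apply: measurable_fun_ltr; [exact: measurable_clock | exact: measurable_arrival].
apply: measurable_forall_in => g g_out.
case: (_ && _) => /=; last exact: measurable_cst.
by apply: measurable_fun_ltr; exact: measurable_arrival.
Qed.

Lemma measurable_explored fs : history E s fs ->
  measurable_fun setT (fun z => explored E s (tz z) fs).
Proof.
move=> hfs; apply: measurable_and; first exact: measurable_inner.
apply: measurable_forall_in => g g_out.
by apply: measurable_fun_ltr; [exact: measurable_clock | exact: measurable_arrival].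
Qed.

Lemma measurable_path_time x q : path E x q ->
  measurable_fun setT (fun z => path_time (tz z) x q).
Proof.
elim: q x => [|y q IH] x /=.
  by move=> _; under eq_fun do rewrite /path_time big_nil; exact: measurable_cst.
move=> /andP[Exy pq]; under eq_fun do rewrite path_time_cons.
by apply: measurable_funD; [exact: mt (path_edge_mem Exy) | exact: IH].
Qed.

Lemma measurable_edge_sum r : {subset r <= edges E} ->
  measurable_fun setT (fun z => \sum_(f <- r) tz z f).
Proof.
elim: r => [|f r IH] sub.
  by under eq_fun do rewrite big_nil; exact: measurable_cst.
under eq_fun do rewrite big_cons; apply: measurable_funD.
  by apply: mt; rewrite sub ?mem_head.
by apply: IH => g gr; rewrite sub// in_cons gr orbT.
Qed.

Lemma measurable_bigmin (I : finType) (p : pred I) (F : I -> Z -> \bar R) x0 :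
  (forall i, p i -> measurable_fun setT (F i)) ->
  measurable_fun setT (fun z => \big[Order.min/x0]_(i | p i) F i z).
Proof.
move=> mF; elim: (index_enum I) => [|i r IH].
  by under eq_fun do rewrite big_nil; exact: measurable_cst.
by case pi: (p i); under eq_fun do rewrite big_cons pi;
  [apply: measurable_mine; [exact: mF | exact: IH] | exact: IH].
Qed.

Lemma measurable_bigmax (I : finType) (p : pred I) (F : I -> Z -> \bar R) x0 :
  (forall i, p i -> measurable_fun setT (F i)) ->
  measurable_fun setT (fun z => \big[Order.max/x0]_(i | p i) F i z).
Proof.
move=> mF; elim: (index_enum I) => [|i r IH].
  by under eq_fun do rewrite big_nil; exact: measurable_cst.
by case pi: (p i); under eq_fun do rewrite big_cons pi;
  [apply: measurable_maxe; [exact: mF | exact: IH] | exact: IH].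
Qed.

Lemma measurable_cover_time : measurable_fun setT (fun z => cover_time E (tz z) s).
Proof.
apply: measurable_bigmax => v _; apply: measurable_bigmin => q /andP[/andP[pq _] _].
by apply/measurable_EFinP; exact: measurable_path_time.
Qed.

End Measurability.

Section Events.
Local Open Scope classical_set_scope.
Context {R : realType} d (T : measurableType d) (mu : probability T R).

(** Real-valued, so that sums of probabilities of events compare with the real-valued
    [tree_law]. *)
Definition pr (b : T -> bool) : R := fine (mu [set t | b t]).

Lemma measurable_event (b : T -> bool) : measurable_fun setT b ->
  measurable [set t | b t].
Proof.
move=> mb; rewrite -[X in measurable X]setTI.
by rewrite (_ : [set t | b t] = b @^-1` [set true])//; exact: mb.
Qed.

Lemma prE (b : T -> bool) : measurable_fun setT b -> (pr b)%:E = mu [set t | b t].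
Proof. by move=> mb; rewrite fineK// fin_num_measure//; exact: measurable_event. Qed.

Lemma pr_integral (b : T -> bool) : measurable_fun setT b ->
  ((pr b)%:E = \int[mu]_t (b t)%:R%:E)%E.
Proof.
move=> mb; rewrite prE// -[in LHS](setIT [set t | b t]) -integral_indic//.
  apply: eq_integral => t _; rewrite indicE.
  case bt: (b t); first by rewrite mem_set.
  by rewrite memNset//= bt.
exact: measurable_event.
Qed.

Lemma pr_ge0 b : 0 <= pr b. Proof. exact: fine_ge0. Qed.

Lemma pr_le (b c : T -> bool) : measurable_fun setT b -> measurable_fun setT c ->
  (forall t, b t -> c t) -> pr b <= pr c.
Proof.
move=> mb mc bc; rewrite -lee_fin !prE//; apply: le_measure; rewrite ?inE;
  [exact: measurable_event|exact: measurable_event|exact: bc].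
Qed.

Lemma pr_le1 (b : T -> bool) : measurable_fun setT b -> pr b <= 1.
Proof.
move=> mb; rewrite -lee_fin prE//; apply: probability_le1.
exact: measurable_event.
Qed.

Lemma pr_or (b c : T -> bool) : measurable_fun setT b -> measurable_fun setT c ->
  pr (fun t => b t || c t) <= pr b + pr c.
Proof.
move=> mb mc; rewrite -lee_fin EFinD !prE//; last exact: measurable_or.
rewrite (_ : [set t | _] = [set t | b t] `|` [set t | c t]).
  by apply: measureU2; exact: measurable_event.
by apply/seteqP; split=> t /= => [/orP|/orP].
Qed.

Lemma measurable_has (I : Type) (r : seq I) (b : I -> T -> bool) :
  (forall i, measurable_fun setT (b i)) ->
  measurable_fun setT (fun t => has (b ^~ t) r).
Proof.
move=> mb; elim: r => [|i r IH] /=; first exact: measurable_cst.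
exact: measurable_or.
Qed.

Lemma pr_false : pr (fun=> false) = 0.
Proof.
rewrite /pr (_ : [set t | _] = set0) ?measure0//.
by apply/seteqP; split.
Qed.

Lemma pr_has (I : Type) (r : seq I) (b : I -> T -> bool) :
  (forall i, measurable_fun setT (b i)) ->
  pr (fun t => has (b ^~ t) r) <= \sum_(i <- r) pr (b i).
Proof.
move=> mb; elim: r => [|i r IH] /=; first by rewrite big_nil pr_false.
rewrite big_cons (le_trans (pr_or _ _))//; first exact: measurable_has.
by rewrite lerD2l.
Qed.

End Events.

(** * Probabilities of histories and of fast paths *)

Section Growth.
Local Open Scope classical_set_scope.
Context {R : realType} {V : finType} (E : rel V) (s : V).
Hypotheses (E_sym : symmetric E) (E_irr : irreflexive E).
Local Notation W := (weights (R := R) (edges E)).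
Variable mu : probability W R.
Hypothesis mu_resampling : resampling mu.

Let mcoord f : f \in edges E -> measurable_fun setT (fun t : W => t f : R).
Proof. exact: measurable_coord. Qed.

Let mexplored fs : history E s fs ->
  measurable_fun setT (fun t : W => explored E s t fs).
Proof. by move=> ?; exact: measurable_explored. Qed.

Let mexplored_first fs f : history E s fs -> f \in boundary E s fs ->
  measurable_fun setT (fun t : W => explored E s t fs && arrives_first E s t fs f).
Proof.
move=> hfs f_out; apply: measurable_and; first exact: mexplored.
exact: measurable_arrives_first.
Qed.

Lemma integral_resample2 f g (b : W -> bool) : f \in edges E -> g \in edges E ->
  measurable_fun setT b ->
  ((pr mu b)%:E = \int[mu]_t \int[exp1]_x \int[exp1]_y
     (b (upd (upd t f x) g y))%:R%:E)%E.
Proof.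
move=> fE gE mb; rewrite pr_integral//.
have mF : measurable_fun setT (fun t : W => (b t)%:R%:E : \bar R).
  exact: measurable_bool_EFin.
rewrite (mu_resampling gE)//.
rewrite (mu_resampling fE)//; last by move=> t; exact: integral_ge0.
apply: (measurable_fun_fubini_tonelli_F (m2 := exp1)
  (fun z : W * measurableTypeR R => (b (upd z.1 g z.2))%:R%:E)) => //.
apply: (measurableT_comp mF).
exact: (measurable_upd g measurable_fst measurable_snd).
Qed.

(** Redraw [f] and [g]; for fixed times of all other edges the two events are the
    two outcomes of a race, which [exp1_race_sym] exchanges. *)
Lemma pr_first_sym fs f g : history E s fs ->
  f \in boundary E s fs -> g \in boundary E s fs ->
  pr mu (fun t => explored E s t fs && arrives_first E s t fs f)
  = pr mu (fun t => explored E s t fs && arrives_first E s t fs g).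
Proof.
move=> hfs f_out g_out; have [->//|fg] := eqVneq f g.
have fE := boundary_edges f_out; have gE := boundary_edges g_out.
apply: EFin_inj; rewrite (integral_resample2 fE gE (mexplored_first hfs f_out)).
rewrite (integral_resample2 fE gE (mexplored_first hfs g_out)).
apply: eq_integral => t _.
pose a := clock s t fs - birth s t fs (gate s fs f).
pose b := clock s t fs - birth s t fs (gate s fs g).
pose c := inner E s t fs &&
  [forall h in rivals E s fs f g, clock s t fs < arrival s t fs h].
pose C (z : measurableTypeR R) :=
  [forall h in rivals E s fs f g, z < arrival s t fs h - clock s t fs].
have updt x y h : h != f -> h != g -> upd (upd t f x) g y h = t h.
  by rewrite /upd => /negbTE-> /negbTE->.
have updf x y : upd (upd t f x) g y f = x by rewrite /upd (negbTE fg) eqxx.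
have updg x y : upd (upd t f x) g y g = y by rewrite /upd eqxx.
have evf x y : explored E s (upd (upd t f x) g y) fs &&
    arrives_first E s (upd (upd t f x) g y) fs f
  = c && [&& a < x, b < y, x - a < y - b & C (x - a)].
  rewrite (@race_event R V E s E_sym E_irr t _ fs f g)//; last exact: updt.
  by rewrite updf updg.
have evg x y : explored E s (upd (upd t f x) g y) fs &&
    arrives_first E s (upd (upd t f x) g y) fs g
  = c && [&& a < x, b < y, y - b < x - a & C (y - b)].
  rewrite (@race_event R V E s E_sym E_irr t _ fs g f)//; last 2 first.
  - by rewrite eq_sym.
  - by move=> h hg hf; exact: updt.
  rewrite /c /C /rivals finset.setUC updf updg -/a -/b; congr (_ && _).
  by rewrite andbCA.
transitivity (\int[exp1]_x \int[exp1]_y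
    (c && [&& a < x, b < y, x - a < y - b & C (x - a)])%:R%:E)%E.
  by apply: eq_integral => x _; apply: eq_integral => y _; rewrite evf.
transitivity (\int[exp1]_x \int[exp1]_y
    (c && [&& a < x, b < y, y - b < x - a & C (y - b)])%:R%:E)%E; last first.
  by apply: eq_integral => x _; apply: eq_integral => y _; rewrite evg.
have [cT|//] := boolP c.
have /andP[inT _] := cT.
apply: exp1_race_sym.
- by rewrite subr_ge0 (birth_le_clock hfs inT)// (gate_mem E_sym E_irr f_out).
- by rewrite subr_ge0 (birth_le_clock hfs inT)// (gate_mem E_sym E_irr g_out).
- by apply: measurable_forall_in => h _; exact: measurable_fun_ltr.
Qed.

(** At most one boundary edge arrives strictly first, so the equal probabilities of
    [pr_first_sym] add up to at most the probability of the past. *)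
Lemma pr_explored_cons fs f : history E s fs -> f \in boundary E s fs ->
  pr mu (fun t => explored E s t (f :: fs))
  <= pr mu (fun t => explored E s t fs) / #|boundary E s fs|%:R.
Proof.
move=> hfs f_out.
have hffs : history E s (f :: fs) by rewrite /= f_out.
have b_gt0 : 0 < #|boundary E s fs|%:R :> R.
  by rewrite ltr0n; apply/card_gt0P; exists f.
rewrite ler_pdivlMr//.
apply: (@le_trans _ _ (pr mu (fun t => explored E s t fs && arrives_first E s t fs f)
   * #|boundary E s fs|%:R)).
  apply: ler_wpM2r; first exact: ltW.
  apply: pr_le => [| |t]; [exact: mexplored | exact: mexplored_first |].
  exact: explored_arrives_first.
pose F g (t : W) : \bar R :=
  [&& g \in boundary E s fs, explored E s t fs & arrives_first E s t fs g]%:R%:E.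
have mF g : measurable_fun setT (F g).
  apply: measurable_bool_EFin; case g_out: (g \in boundary E s fs) => /=.
    exact: mexplored_first.
  exact: measurable_cst.
have F0 g t : (0 <= F g t)%E by rewrite lee_fin.
rewrite mulr_natr -sumr_const -lee_fin big_mkcond /= -sumEFin.
rewrite (pr_integral mu (mexplored hfs)).
apply: (@le_trans _ _ (\int[mu]_t \sum_(g : {set V}) F g t)%E).
  rewrite ge0_integral_sum//; refine (lee_sum _ _) => g _.
  case: ifP => [g_out|_]; last by apply: integral_ge0 => t _; exact: F0.
  rewrite (pr_first_sym hfs f_out g_out) (pr_integral mu (mexplored_first hfs g_out)).
  by rewrite /F g_out.
apply: ge0_le_integral => //.
- by move=> t _; exact: sume_ge0.
- exact: emeasurable_sum.
- by apply: measurable_bool_EFin; exact: mexplored.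
move=> t _; rewrite sumEFin lee_fin.
have [ex|_] := boolP (explored E s t fs); last first.
  by rewrite big1// => g _; rewrite andbF.
have [/existsP[g /andP[g_out g1]]|/existsPn none] :=
    boolP [exists g, (g \in boundary E s fs) && arrives_first E s t fs g]; last first.
  by rewrite big1// => g _; rewrite /= (negbTE (none g)).
rewrite (bigD1 g)//= g_out g1 big1 ?addr0// => h hg.
have [h_out|//] := boolP (h \in boundary E s fs).
have /forall_inP/(_ h h_out) := g1; rewrite hg /= => gh.
rewrite /arrives_first; case: forall_inP => // /(_ g g_out).
by rewrite eq_sym hg /= => /(lt_trans gh); rewrite ltxx.
Qed.

(** Follows the recursion of [tree_law]: by [pr_explored_cons] each history of
    length [k] passes on at most its probability times the transition
    probability. *)
Lemma histories_tree_law k (T : subgraph V) :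
  \sum_(fs <- histories E s k | grown s fs == T) pr mu (fun t => explored E s t fs)
  <= tree_law R E s k T.
Proof.
elim: k T => [|k IH] T.
  rewrite big_mkcond big_seq1 /= eq_sym; case: eqP => // _.
  exact: pr_le1 (mexplored (fs := [::]) isT).
rewrite [histories _ _ _]/= big_mkcond big_allpairs_dep /=.
apply: (@le_trans _ _ (\sum_(fs <- histories E s k)
    pr mu (fun t => explored E s t fs) * tree_step R E (grown s fs) T)).
  rewrite big_seq [leRHS]big_seq; apply: ler_sum => fs /historiesP[hfs _].
  rewrite big_enum -big_mkcondr /tree_step -sumr_const mulr_suml mulr_sumr /=.
  rewrite [leLHS](eq_bigl (fun f => f \in [set f in out_edges E (grown s fs) |
      add_edge (grown s fs) f == T]%SET)); last by move=> f; rewrite finset.in_set.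
  apply: ler_sum => f; rewrite finset.in_set => /andP[f_out _].
  by rewrite mul1r; exact: pr_explored_cons.
rewrite (partition_big (grown s) predT)//=; apply: ler_sum => T0 _.
rewrite -big_filter.
apply: (@le_trans _ _ ((\sum_(fs <- histories E s k | grown s fs == T0)
   pr mu (fun t => explored E s t fs)) * tree_step R E T0 T)).
  by rewrite big_filter mulr_suml; apply: ler_sum => fs /eqP->.
by apply: ler_wpM2r => //; rewrite /tree_step divr_ge0.
Qed.

Lemma spanning_tree_prob_ge (A : pred (subgraph V)) :
  \sum_(fs <- histories E s #|V|.-1 | A (grown s fs)) pr mu (fun t => explored E s t fs)
  <= spanning_tree_prob R E s A.
Proof.
rewrite (partition_big (grown s) A)//=; apply: ler_sum => T AT.
rewrite (le_trans _ (histories_tree_law _ T))// big_mkcond [leRHS]big_mkcond.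
apply: ler_sum => fs _; case: (grown s fs =P T) => [->|_]; first by rewrite AT.
by rewrite andbF.
Qed.

(** Fubini in the direction of one edge. *)
Lemma pr_null f (b : W -> bool) : f \in edges E -> measurable_fun setT b ->
  (forall t, exp1 [set x : measurableTypeR R | b (upd t f x)] = 0%E) -> pr mu b = 0.
Proof.
move=> fE mb null; apply: EFin_inj; rewrite pr_integral//.
have mF : measurable_fun setT (fun t : W => (b t)%:R%:E : \bar R).
  exact: measurable_bool_EFin.
rewrite (mu_resampling fE)//; apply: integral0_eq => t _.
have mbt : measurable_fun setT (fun x : measurableTypeR R => b (upd t f x)).
  apply: (measurableT_comp mb); apply: (measurable_upd f) => //.
have prN : (pr exp1 (fun x => b (upd t f x)))%:E = 0%E by rewrite prE//; exact: null.
by rewrite -[RHS]prN pr_integral.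
Qed.

(** Given all passage times but that of [f], a tie fixes the passage time of [f],
    and the exponential law has no atoms. *)
Lemma pr_tie fs f g : history E s fs -> f \in boundary E s fs ->
  g \in boundary E s fs -> f != g ->
  pr mu (fun t => arrival s t fs f == arrival s t fs g) = 0.
Proof.
move=> hfs f_out g_out fg.
apply: (pr_null (boundary_edges f_out)).
  apply: measurable_fun_eqr.
    exact: (measurable_arrival mcoord hfs f_out).
  exact: (measurable_arrival mcoord hfs g_out).
move=> t; have bE x u : u \in (grown s fs).1 ->
    birth s (upd t f x) fs u = birth s t fs u.
  have [|bE _ _] := @locality R V E s E_sym E_irr (upd t f x) t fs hfs; last exact: bE.
  move=> h _ hT; rewrite /upd; case: eqP => // hf.
  by have := out_edge_not_subset E_sym E_irr f_out; rewrite -hf hT.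
have gT := gate_mem E_sym E_irr g_out; have fT := gate_mem E_sym E_irr f_out.
have gf : (g == f) = false by rewrite eq_sym (negbTE fg).
rewrite -[RHS](exp1_set1 (arrival s t fs g - birth s t fs (gate s fs f))).
congr (exp1 _); apply/seteqP; split=> x /=; rewrite /arrival !bE//.
  by rewrite /upd eqxx gf => /eqP <-; rewrite addrAC subrr add0r.
by rewrite /upd eqxx gf => ->; rewrite addrC subrK.
Qed.

Lemma pr_edge_le0 f : f \in edges E -> pr mu (fun t => t f <= 0) = 0.
Proof.
move=> fE; apply: (pr_null fE).
  by apply: measurable_fun_ler => //; exact: mcoord.
move=> t; rewrite -[RHS]exp1_le0; congr (exp1 _).
by apply/seteqP; split=> x /=; rewrite /upd eqxx.
Qed.

(** Independence enters through resampling the first edge: as it does not occur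
    among the others, its factor comes out of the integral. *)
Lemma laplace_sum (es : seq {set V}) (theta : R) : 0 < theta ->
  uniq es -> {subset es <= edges E} ->
  (\int[mu]_t (expR (- theta * \sum_(e <- es) t e))%:E <= (theta^-1 ^+ size es)%:E)%E.
Proof.
move=> theta0; elim: es => [|e es IH] /=.
  move=> _ _; under eq_integral do rewrite big_nil mulr0 expR0.
  by rewrite integral_cst// mul1e; exact: probability_le1.
move=> /andP[e_es uniq_es] sub; have eE : e \in edges E by rewrite sub ?mem_head.
have {}IH := IH uniq_es (fun f fes => sub f (mem_behead (s := e :: es) fes)).
have mS r : {subset r <= edges E} ->
    measurable_fun setT (fun t : W => (expR (- theta * \sum_(e <- r) t e))%:E : \bar R).
  move=> subr; apply/measurable_EFinP; apply: measurableT_comp => //.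
  by apply: measurable_funM => //; exact: measurable_edge_sum mcoord _ subr.
have mSes := mS es (fun f fes => sub f (mem_behead (s := e :: es) fes)).
have mexp : measurable_fun [set: measurableTypeR R]
    (fun x : measurableTypeR R => (expR (- theta * x))%:E : \bar R).
  by apply/measurable_EFinP/measurableT_comp => //; exact: measurable_funM.
rewrite (mu_resampling eE)//; last exact: mS.
apply: (@le_trans _ _ (\int[mu]_t
    ((theta^-1)%:E * (expR (- theta * \sum_(f <- es) t f))%:E))%E); last first.
  rewrite ge0_integralZl//; last by rewrite lee_fin invr_ge0 ltW.
  by rewrite exprS EFinM lee_wpmul2l// lee_fin invr_ge0 ltW.
have split_exp (t : W) x : (expR (- theta * \sum_(f <- e :: es) upd t e x f))%:E =
    ((expR (- theta * \sum_(f <- es) t f))%:E * (expR (- theta * x))%:E)%E.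
  have -> : \sum_(f <- e :: es) upd t e x f = \sum_(f <- es) t f + x.
    rewrite big_cons {1}/upd eqxx addrC; congr (_ + _).
    apply: eq_big_seq => f fes; rewrite /upd; case: eqP => // fe.
    by rewrite -fe fes in e_es.
  by rewrite mulrDr expRD EFinM.
have splitI (t : W) :
    (\int[exp1]_x (expR (- theta * \sum_(f <- e :: es) upd t e x f))%:E
     = (expR (- theta * \sum_(f <- es) t f))%:E * \int[exp1]_x (expR (- theta * x))%:E)%E.
  rewrite -ge0_integralZl//.
  by apply: eq_integral => x _; exact: split_exp.
apply: ge0_le_integral => //.
- by move=> t _; apply: integral_ge0 => x _; rewrite lee_fin expR_ge0.
- rewrite (_ : (fun t => _) = fun t : W => ((expR (- theta * \sum_(f <- es) t f))%:E *
    \int[exp1]_x (expR (- theta * x))%:E)%E); last by apply/funext => t; exact: splitI.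
  exact: emeasurable_funM.
- exact: emeasurable_funM.
move=> t _; rewrite splitI muleC lee_wpmul2r ?lee_fin ?expR_ge0//.
exact: exp1_laplace.
Qed.

Definition path_edges (x : V) (q : seq V) : seq {set V} :=
  [seq [set xy.1; xy.2]%SET | xy <- zip (x :: q) q].

Lemma path_edges_sub x q f : f \in path_edges x q -> f \subset x :: q.
Proof.
elim: q x => [|y q IH] x //=; rewrite in_cons => /predU1P[->|/IH fq].
  by apply/fintype.subsetP => z /set2P[]->; rewrite !inE eqxx ?orbT.
rewrite (fintype.subset_trans fq)//; apply/fintype.subsetP => z zq.
by rewrite inE zq orbT.
Qed.

Lemma path_edges_uniq x q : uniq (x :: q) -> uniq (path_edges x q).
Proof.
elim: q x => [//|y q IH] x /= /andP[xq uq].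
apply/andP; split; last exact: IH.
apply: contra xq => /path_edges_sub/fintype.subsetP; apply.
by rewrite !inE eqxx.
Qed.

Lemma path_edges_edges x q : path E x q -> {subset path_edges x q <= edges E}.
Proof.
elim: q x => [//|y q IH] x /= /andP[Exy pq] f; rewrite in_cons => /predU1P[->|].
  exact: path_edge_mem.
exact: IH.
Qed.

(** Markov's inequality for [exp (- theta * path_time)] with [theta = L / K]. *)
Lemma pr_fast_path q (K : R) : 0 < K -> (0 < size q)%N -> simple_path E s q ->
  pr mu (fun t => path_time t s q <= K) <= (expR 1 * K / (size q)%:R) ^+ size q.
Proof.
move=> K0 q0 /andP[pq uq]; set L := size q.
have L0 : 0 < L%:R :> R by rewrite ltr0n.
pose theta : R := L%:R / K; have theta0 : 0 < theta by exact: divr_gt0.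
have mpath : measurable_fun setT (fun t : W => path_time t s q : R).
  exact: (measurable_path_time mcoord pq).
have size_pe : size (path_edges s q) = L.
  by rewrite size_map size_zip /= minnE subSnn subn1.
have := laplace_sum theta0 (path_edges_uniq uq) (path_edges_edges pq).
rewrite size_pe => lap.
have mexp : measurable_fun setT
    (fun t : W => (expR (- theta * path_time t s q))%:E : \bar R).
  by apply/measurable_EFinP/measurableT_comp => //; exact: measurable_funM.
have pathE (t : W) : \sum_(e <- path_edges s q) t e = path_time t s q.
  by rewrite /path_time big_map.
rewrite -lee_fin pr_integral; last exact: measurable_fun_ler.
apply: (@le_trans _ _ (\int[mu]_t
    ((expR L%:R)%:E * (expR (- theta * path_time t s q))%:E))%E).
  apply: ge0_le_integral => //.
  - by apply: measurable_bool_EFin; exact: measurable_fun_ler.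
  - exact: emeasurable_funM.
  move=> t _; rewrite -EFinM -expRD lee_fin.
  have [pK|_] := leP (path_time t s q) K; last by rewrite expR_ge0.
  rewrite -[leLHS]expR0 ler_expR mulNr subr_ge0.
  by rewrite /theta mulrAC ler_pdivrMr// ler_wpM2l// ltW.
rewrite ge0_integralZl//.
under eq_integral do rewrite -pathE.
apply: (le_trans (lee_wpmul2l _ lap)); first by rewrite lee_fin expR_ge0.
have -> : expR L%:R = expR 1 ^+ L :> R by rewrite -expRM_natl mulr1.
by rewrite -EFinM lee_fin /theta invf_div -exprMn mulrA.
Qed.

End Growth.

(** * The union bound *)

Section UnionBound.
Local Open Scope classical_set_scope.
Context {R : realType} {V : finType} (E : rel V) (s : V).
Hypothesis hG : connected_sgraph E.
Local Notation W := (weights (R := R) (edges E)).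
Variable mu : probability W R.
Hypothesis mu_resampling : resampling mu.

Let E_sym : symmetric E. Proof. by case: hG. Qed.
Let E_irr : irreflexive E. Proof. by case: hG. Qed.
Let E_conn x y : connect E x y. Proof. by case: hG. Qed.

Let mcoord f : f \in edges E -> measurable_fun setT (fun t : W => t f : R).
Proof. exact: measurable_coord. Qed.

Lemma measurable_guard d (T : measurableType d) (c : bool) (b : T -> bool) :
  (c -> measurable_fun setT b) -> measurable_fun setT (fun t => c && b t).
Proof. by case: c => [mb|_]; [exact: mb | exact: measurable_cst]. Qed.

Lemma pr_has0 (I : Type) (r : seq I) (b : I -> W -> bool) :
  (forall i, measurable_fun setT (b i)) -> (forall i, pr mu (b i) = 0) ->
  pr mu (fun t => has (b ^~ t) r) = 0.
Proof.
move=> mb b0; apply/eqP; rewrite eq_le pr_ge0 andbT.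
by rewrite (le_trans (pr_has _ _ mb))// big1.
Qed.

(** In this and the next definitions a guard makes the event trivially false
    outside the range where it is measurable, so that unions of these events may
    range over arbitrary lists. *)
Definition nonpos_edge (f : {set V}) (t : W) : bool := (f \in edges E) && (t f <= 0).

Definition tie (x : seq {set V} * ({set V} * {set V})) (t : W) : bool :=
  [&& history E s x.1, x.2.1 \in boundary E s x.1, x.2.2 \in boundary E s x.1 &
      x.2.1 != x.2.2] && (arrival s t x.1 x.2.1 == arrival s t x.1 x.2.2).

Definition valid_exploration (fs : seq {set V}) (t : W) : bool :=
  history E s fs && explored E s t fs.

Definition fast (K : R) {L} (q : L.-tuple V) (t : W) : bool :=
  simple_path E s q && (path_time t s q <= K).

Lemma measurable_nonpos_edge f : measurable_fun setT (nonpos_edge f).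
Proof.
by apply: measurable_guard => fE; apply: measurable_fun_ler => //; exact: mcoord.
Qed.

Lemma measurable_tie x : measurable_fun setT (tie x).
Proof.
apply: measurable_guard => /and4P[hfs f_out g_out _].
by apply: measurable_fun_eqr;
  [exact: (measurable_arrival mcoord hfs f_out) |
   exact: (measurable_arrival mcoord hfs g_out)].
Qed.

Lemma measurable_valid_exploration fs : measurable_fun setT (valid_exploration fs).
Proof. by apply: measurable_guard => hfs; exact: (measurable_explored mcoord hfs). Qed.

Lemma measurable_fast K L (q : L.-tuple V) : measurable_fun setT (fast K q).
Proof.
apply: measurable_guard => /andP[pq _].
by apply: measurable_fun_ler => //; exact: (measurable_path_time mcoord pq).
Qed.

Let short_histories : seq (seq {set V}) :=
  flatten [seq histories E s j | j <- iota 0 #|V|].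

(** The events whose probabilities the union bound adds up.  Outside the last two the
    exploration reaches every vertex; the tree that it builds is short, or slow, or
    contains a fast path. *)
Lemma growth_cover (K : R) L (t : W) :
  [|| has (valid_exploration ^~ t)
        [seq fs <- histories E s #|V|.-1 | (height s (grown s fs) <= L)%N],
      (K%:E < cover_time E t s)%E,
      has (fast K ^~ t) (enum {: L.-tuple V}),
      has (nonpos_edge ^~ t) (enum {set V}) |
      has (tie ^~ t) [seq (fs, fg) | fs <- short_histories,
                                     fg <- enum {: {set V} * {set V}}]].
Proof.
case: ltP => [_|covK]; first by rewrite !orbT.
have [|/hasPn pos] := boolP (has (nonpos_edge ^~ t) _); first by rewrite !orbT.
have [|/hasPn notie] := boolP (has (tie ^~ t) _); first by rewrite !orbT.
have {}pos f : f \in edges E -> 0 < t f.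
  move=> fE; have := pos f; rewrite mem_enum inE /nonpos_edge fE -ltNge.
  exact.
have V0 : (0 < #|V|)%N by apply/card_gt0P; exists s.
have [||fs fsn exfs] := @explored_exists R V E s E_sym E_irr t #|V|.-1 E_conn pos.
- move=> j fs f g jV fsj f_out g_out fg.
  have [hfs _] := historiesP fsj.
  have /notie : (fs, (f, g)) \in [seq (fs, fg) | fs <- short_histories,
      fg <- enum {: {set V} * {set V}}].
    apply/allpairsP; exists (fs, (f, g)); split=> //=; last by rewrite mem_enum.
    apply/flattenP; exists (histories E s j) => //.
    by apply/mapP; exists j => //; rewrite mem_iota add0n.
  by rewrite /tie /= hfs f_out g_out fg.
- by rewrite prednK.
have [hfs _] := historiesP fsn.
have [short|tall] := leqP (height s (grown s fs)) L.
  apply/orP; left; apply/hasP; exists fs; first by rewrite mem_filter short.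
  by rewrite /valid_exploration hfs.
have [q sq qK] := fast_path E_sym E_irr (fun f fE => ltW (pos f fE)) hfs exfs covK tall.
apply/orP; right; rewrite !orbF /=; apply/hasP; exists q; first by rewrite mem_enum.
by rewrite /fast sq.
Qed.

Lemma union_bound (K : R) L : 0 < K -> (0 < L)%N ->
  1 <= spanning_tree_prob R E s (fun T => (height s T <= L)%N)
       + pr mu (fun t => (K%:E < cover_time E t s)%E)
       + (num_simple_paths E s L)%:R * (expR 1 * K / L%:R) ^+ L.
Proof.
move=> K0 L0.
have mcov : measurable_fun setT (fun t : W => (K%:E < cover_time E t s)%E).
  apply: (measurable_fun_bool true) => //.
  rewrite (_ : _ @^-1` _ = [set t | K%:E < cover_time E t s]%E)//.
  apply: emeasurable_fun_o_infty => //; exact: (measurable_cover_time _ mcoord).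
have mgood := measurable_has
  [seq fs <- histories E s #|V|.-1 | (height s (grown s fs) <= L)%N]
  measurable_valid_exploration.
have mfast := measurable_has (enum {: L.-tuple V}) (measurable_fast K (L := L)).
have mpos := measurable_has (enum {set V}) measurable_nonpos_edge.
have mtie := measurable_has
  [seq (fs, fg) | fs <- short_histories, fg <- enum {: {set V} * {set V}}]
  measurable_tie.
have pr1 : pr mu (fun=> true) = 1.
  apply: EFin_inj; rewrite prE; last exact: measurable_cst.
  by rewrite -[RHS](@probability_setT _ _ _ mu); congr (mu _); apply/seteqP.
rewrite -[leLHS]pr1 -addrA.
rewrite (le_trans (@pr_le _ _ _ _ _ _ _ _ (fun t _ => growth_cover K L t)))//.
  by do 4 (apply: measurable_or => //).
rewrite (le_trans (pr_or _ mgood _))//; first by do 3 (apply: measurable_or => //).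
apply: lerD.
  rewrite (le_trans _ (spanning_tree_prob_ge s E_sym E_irr mu_resampling _))//.
  rewrite (le_trans (pr_has _ _ measurable_valid_exploration))// big_filter.
  rewrite big_seq_cond [leRHS]big_seq_cond.
  apply: ler_sum => fs /andP[/historiesP[hfs _] _].
  apply: pr_le => [| |t /andP[]//]; first exact: measurable_valid_exploration.
  exact: (measurable_explored mcoord hfs).
rewrite (le_trans (pr_or _ mcov _))//; first by do 2 (apply: measurable_or => //).
rewrite lerD2l (le_trans (pr_or _ mfast _))//; first exact: measurable_or.
rewrite -[leRHS]addr0; apply: lerD; last first.
  rewrite (le_trans (pr_or _ mpos mtie))// (pr_has0 _ measurable_nonpos_edge); last first.
    move=> f; rewrite /nonpos_edge; have [fE|_] := boolP (f \in edges E).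
      exact: pr_edge_le0.
    exact: pr_false.
  rewrite add0r pr_has0//; first exact: measurable_tie.
  move=> [fs [f g]]; rewrite /tie /=.
  have [/and4P[hfs f_out g_out fg]|_] := boolP [&& _, _, _ & _]; last exact: pr_false.
  exact: (pr_tie E_sym E_irr mu_resampling hfs f_out g_out fg).
rewrite (le_trans (pr_has _ _ (measurable_fast K (L := L))))//.
rewrite /num_simple_paths mulr_natl -sumr_const big_enum /= [leRHS]big_mkcond /=.
apply: ler_sum => q _; rewrite inE /fast; case: ifP => sq; last by rewrite pr_false.
have := @pr_fast_path R V E s mu mu_resampling q K K0; rewrite size_tuple.
exact.
Qed.

End UnionBound.

Theorem lemma2 (R : realType) (V : finType) (E : rel V) (s : V)
    (hG : connected_sgraph E)
    (d : measure_display) (Omega : measurableType d) (P : probability Omega R)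
    (tau : {set V} -> {RV P >-> R}) (htau : iid_exp1_on_edges E tau)
    (p a c K : R) (L : nat)
    (hp0 : 0 <= p) (hp1 : p < 1) (ha : 1 <= a) (hc : 0 < c) (hK : 0 < K)
    (hL : L%:Z = Num.ceil (c * expR 1 * a * K))
    (hcover : (P [set w | K%:E < cover_time E (fun f => tau f w) s]%classic
               <= p%:E)%E)
    (hpaths : (num_simple_paths E s L)%:R <= a ^+ L) :
  1 - p - c ^- L
    <= spanning_tree_prob R E s (fun T => (height s T <= L)%N).
Proof.
have [indep law] := htau.
have x_gt0 : 0 < c * expR 1 * a * K.
  by rewrite !mulr_gt0 ?expR_gt0// (lt_le_trans ltr01).
have x_le_L : c * expR 1 * a * K <= L%:R.
  by have := ceil_ge (c * expR 1 * a * K); rewrite -hL.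
have L_gt0 : 0 < L%:R :> R by exact: lt_le_trans x_le_L.
have L0 : (0 < L)%N by rewrite -(ltr0n R).
have mu_resampling := resampling_law indep law.
have := union_bound s hG mu_resampling hK L0.
set tall := spanning_tree_prob _ _ _ _; set slow := pr _ _.
have slow_p : slow <= p.
  rewrite /slow /pr -lee_fin fineK//.
  by rewrite ge0_fin_numE// (le_lt_trans hcover)// ltry.
have B0 : 0 <= expR 1 * K / L%:R by rewrite divr_ge0 ?mulr_ge0 ?expR_ge0 // ltW.
have paths_c : (num_simple_paths E s L)%:R * (expR 1 * K / L%:R) ^+ L <= c ^- L.
  apply: (le_trans (ler_wpM2r (exprn_ge0 L B0) hpaths)).
  rewrite -exprMn -exprVn; apply: lerXn2r; rewrite ?nnegrE.
  - by rewrite mulr_ge0// (le_trans ler01).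
  - by rewrite invr_ge0 ltW.
  rewrite mulrA ler_pdivrMr// [leRHS]mulrC ler_pdivlMr//.
  by apply: le_trans x_le_L; rewrite le_eqVlt; apply/orP; left; apply/eqP; ring.
lra.
Qed.
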